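(* Let $k$ be a field of characteristic zero. Let $f(t)$ and $g(t)$ be irreducible polynomials in $k[t]$ of degree $d$ such that their splitting fields are linearly disjoint over $k$. If at least one of $f$ and $g$ has primitive Galois group (as a permutation group on its roots), then $\Pi_{f,g}=0$, except when $d$ is an odd prime and both polynomials have cyclic Galois groups. For any $d$, if $G_f\simeq G_g\simeq\mathbb{Z}/d$, then $\Pi_{f,g}\cong\mathbb{Z}/d$ if $d$ is odd, and $\Pi_{f,g}\cong\mathbb{Z}/(d/2)$ if $d$ is even.
   Context: Let $k_f,k_g$ be the splitting fields of $f,g$ (linearly disjoint means $k_f\cap k_g=k$), $G_f=\mathrm{Gal}(k_f/k)$, $G_g=\mathrm{Gal}(k_g/k)$. Fix a root $\xi\in k_f$ of $f$; $S_f=\mathrm{Gal}(k_f/k(\xi))\subset G_f$ and $N_f$ is the normal closure of $S_f$ in $G_f$. Define $S_g,N_g\subset G_g$ similarly. For a bilinear form $\varphi\colon (G_f/N_f)^{\mathrm{ab}}\times (G_g/N_g)^{\mathrm{ab}}\to\mathbb{Z}/d$ let $\widetilde\varphi\colon (G_f/S_f)\times(G_g/S_g)\to\mathbb{Z}/d$ be the function obtained from $\varphi$ via the canonical surjections $G_f/S_f\to (G_f/N_f)^{\mathrm{ab}}$ and $G_g/S_g\to (G_g/N_g)^{\mathrm{ab}}$. Define $\Pi_{f,g}\subset\mathrm{Hom}((G_f/N_f)^{\mathrm{ab}}\otimes(G_g/N_g)^{\mathrm{ab}},\mathbb{Z}/d)$ as the subgroup of those $\varphi$ with $$\sum_{y\in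 G_g/S_g}\widetilde\varphi(\alpha,y)=\sum_{x\in G_f/S_f}\widetilde\varphi(x,\beta)=0\quad\text{for all }\alpha\in G_f/S_f,\ \beta\in G_g/S_g.$$ A transitive permutation group is primitive if the stabiliser of a point is a maximal subgroup. *)

(* Defs.v *)
From HB Require Import structures.
From mathcomp Require Import all_boot all_order all_algebra all_fingroup.
From mathcomp Require Import all_solvable all_field.

Set Implicit Arguments.
Unset Strict Implicit.
Unset Printing Implicit Defensive.

Import GRing.Theory.

(* The additive group Z/n for n > 0.  Unlike 'Z_n it is correct for n = 1,    *)
(* where 'I_1 is the trivial group; n = 0 is not meaningful.                  *)
Notation Zmod n := 'I_(n.-1.+1).

HB.instance Definition _ (T : finType) (M : finZmodType) :=
  [finGroupMixin of {ffun T -> M} for +%R].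

Section PermutationGroups.

Local Open Scope group_scope.

(* Point stabilisers are required to be proper, since maximal subgroups are;  *)
(* in particular the trivial group on one point is not primitive here.        *)
Definition primitive_perm_group (T : finType) (P : {set {perm T}}) : bool :=
  [transitive P, on [set: T] | 'P] && [forall x : T, maximal 'C_P[x | 'P] P].

End PermutationGroups.

Section NormalClosureQuotient.

Local Open Scope group_scope.

Definition normal_closure (gT : finGroupType) (S G : {set gT}) : {set gT} :=
  <<class_support S G>>.

Canonical normal_closure_group (gT : finGroupType) (S G : {set gT}) : {group gT} :=
  [group of normal_closure S G].

Definition abelianization (gT : finGroupType) (G : {group gT}) :
  {group coset_of G^`(1)} := (G / G^`(1))%G.

Definition ab_quotient (gT : finGroupType) (G S : {group gT}) :=
  abelianization (G / normal_closure S G)%G.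

Lemma normal_closure_normal (gT : finGroupType) (G S : {group gT}) :
  S \subset G -> normal_closure S G <| G.
Proof.
move=> sSG; rewrite /normal gen_subG class_support_sub_norm ?normG //=.
exact/norms_gen/class_support_norm.
Qed.

Lemma sub_normal_closure (gT : finGroupType) (G S : {group gT}) : S \subset normal_closure S G.
Proof. by rewrite sub_gen ?sub_class_support. Qed.

Definition ab_class (gT : finGroupType) (G S : {group gT}) (x : gT) :
    [subg ab_quotient G S] :=
  subg (ab_quotient G S)
       (coset (G / normal_closure S G)^`(1) (coset (normal_closure S G) x)).

(* The canonical surjection G/S -> (G/N)^ab, computed on a representative of  *)
(* the coset; by canonical_surjE the choice of representative is irrelevant.  *)
Definition canonical_surj (gT : finGroupType) (G S : {group gT})
    (a : {set gT}) : [subg ab_quotient G S] :=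
  ab_class G S (repr a).

Lemma canonical_surjE (gT : finGroupType) (G S : {group gT}) (x : gT) :
  canonical_surj G S (S :* x) = ab_class G S x.
Proof.
rewrite /canonical_surj /ab_class.
have /rcosetP[s Ss ->] := mem_repr_rcoset S x.
have Ns := subsetP (sub_normal_closure G S) s Ss.
by rewrite (coset_kerl x Ns).
Qed.

End NormalClosureQuotient.

Section BilinearForms.

Variables (d : nat) (gT hT : finGroupType).

(* Elements of Hom(A (x) B, Z/d), as bilinear forms on A x B; the groups A    *)
(* and B are written multiplicatively and Z/d additively.                     *)
Definition bilinear_form (A : {group gT}) (B : {group hT})
    (phi : {ffun [subg A] * [subg B] -> Zmod d}) : bool :=
  [forall a, forall a', forall b,
     phi ((a * a')%g, b) == (phi (a, b) + phi (a', b))%R] &&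
  [forall a, forall b, forall b',
     phi (a, (b * b')%g) == (phi (a, b) + phi (a, b'))%R].

End BilinearForms.

Section Pi.

Variables (d : nat) (gT hT : finGroupType).
Variables (G S : {group gT}) (H T : {group hT}).

Definition form_on_cosets
    (phi : {ffun [subg ab_quotient G S] * [subg ab_quotient H T]
              -> Zmod d})
    (a : {set gT}) (b : {set hT}) : Zmod d :=
  phi (canonical_surj G S a, canonical_surj H T b).

(* Automorphisms compose from left to right in MathComp, (x * y) a = y (x a), *)
(* so the cosets g S of the usual convention are the right cosets S :* g.     *)
Definition Pi :
    {set {ffun [subg ab_quotient G S] * [subg ab_quotient H T]
            -> Zmod d}} :=
  [set phi | [&& bilinear_form phi,
     [forall a in rcosets S G,
        (\sum_(y in rcosets T H) form_on_cosets phi a y)%R == 0%R] &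
     [forall b in rcosets T H,
        (\sum_(x in rcosets S G) form_on_cosets phi x b)%R == 0%R]]].

Lemma Pi_group_set : group_set Pi.
Proof.
apply/group_setP; split=> [|u v].
  rewrite inE; apply/and3P; split.
  - by apply/andP; split; do 3!apply/forallP=> ?; rewrite !ffunE addr0.
  - by apply/forall_inP=> a _; rewrite big1 // => y _; rewrite /form_on_cosets ffunE.
  - by apply/forall_inP=> a _; rewrite big1 // => y _; rewrite /form_on_cosets ffunE.
rewrite !inE => /and3P[/andP[ul ur] u1 u2] /and3P[/andP[vl vr] v1 v2].
apply/and3P; split.
- apply/andP; split; apply/forallP=> a; apply/forallP=> b; apply/forallP=> c.
    rewrite !ffunE (eqP (forallP (forallP (forallP ul a) b) c)).
    by rewrite (eqP (forallP (forallP (forallP vl a) b) c)) addrACA.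
  rewrite !ffunE (eqP (forallP (forallP (forallP ur a) b) c)).
  by rewrite (eqP (forallP (forallP (forallP vr a) b) c)) addrACA.
- apply/forall_inP=> a Sa; apply/eqP.
  under eq_bigr => y _ do rewrite /form_on_cosets ffunE.
  by rewrite big_split /= (eqP (forall_inP u1 a Sa)) (eqP (forall_inP v1 a Sa)) addr0.
- apply/forall_inP=> a Sa; apply/eqP.
  under eq_bigr => y _ do rewrite /form_on_cosets ffunE.
  by rewrite big_split /= (eqP (forall_inP u2 a Sa)) (eqP (forall_inP v2 a Sa)) addr0.
Qed.

Canonical Pi_group := Group Pi_group_set.

End Pi.

Section GaloisGroupsOfPolynomials.

Variables (k : fieldType) (L : splittingFieldType k).

(* splittingFieldFor with its list of roots made explicit. *)
Definition splitting_field_with_roots (p : {poly k}) (rs : seq L)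
    (K : {subfield L}) : Prop :=
  (map_poly (in_alg L) p %= \prod_(z <- rs) ('X - z%:P))%R /\
  <<1 & rs>>%VS = K :> {vspace L}.

Definition gal_perms (rs : seq L) (K : {subfield L}) :
    {set {perm seq_sub rs}} :=
  [set s : {perm seq_sub rs} |
    [exists u in 'Gal(K / 1%AS)%g,
       forall z : seq_sub rs, val (s z) == u (val z)]].

Lemma gal_perms_group_set (rs : seq L) (K : {subfield L}) :
  {subset rs <= K} -> group_set (gal_perms rs K).
Proof.
move=> rsK; apply/group_setP; split=> [|s t].
  rewrite inE; apply/exists_inP; exists 1%g; first exact: group1.
  by apply/forallP=> z; rewrite perm1 gal_id.
rewrite !inE => /exists_inP[u Gu /forallP su] /exists_inP[v Gv /forallP tv].
apply/exists_inP; exists (u * v)%g; first exact: groupM.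
apply/forallP=> z; rewrite permM (eqP (tv _)) (eqP (su _)) galM //.
exact/rsK/valP.
Qed.

End GaloisGroupsOfPolynomials.

(* Main.v *)
Require Import Defs.
From mathcomp Require Import all_boot all_order all_algebra all_fingroup.
From mathcomp Require Import all_solvable all_field.

(* If S_f is maximal in G_f, its normal closure N_f is G_f or S_f.  In the    *)
(* first case there are no nonzero forms.  In the second S_f is normal, hence *)
(* fixes every root of f and is trivial, so that G_f has no proper nontrivial *)
(* subgroup and d = #|G_f| is prime.  Then S_g, of prime index d, is maximal  *)
(* as well, and the same dichotomy for g leaves only the case of two cyclic   *)
(* groups of order d.  In that case, for any d, a form is c * i * j on powers *)
(* of generators, and lies in Pi if and only if c * d(d - 1)/2 = 0 in Z/d:    *)
(* every c is allowed if d is odd, exactly the even ones if d is even.        *)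

Set Implicit Arguments.
Unset Strict Implicit.
Unset Printing Implicit Defensive.

Import GRing.Theory GroupScope.

(** An irreducible polynomial of degree d gives the order of G as d times that of S
    ([card_gal_irr]), and G moves [xi] to every root. So a normal S fixes all the roots, which
    generate the splitting field, and is trivial ([gal_stab_normal]). With S maximal and N different
    from G, this yields S = 1 and d prime ([gal_maximal_closure]). Primality of d is what passes
    from one polynomial to the other ([gal_prime_maximal]). What then remains of the first claim is
    d = 2, where the group Z/(d/2) of the second claim is trivial.

    For cyclic groups of order d, a form is determined by its value c at a pair of generators, and
    every c in Z/d occurs. Both families of sums consist of multiples of c times 0 + 1 + ... + (d -
    1) = ['C(d, 2)]. So [Pi_cyclic_isog] identifies Pi with the ['C(d, 2)]-torsion of Z/d, which
    [Pi_cyclic_odd] and [Pi_cyclic_even] compute. *)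

Section BilinearForm.

Variables (d : nat) (gT hT : finGroupType) (A : {group gT}) (B : {group hT}).
Variable phi : {ffun [subg A] * [subg B] -> Zmod d}.
Hypothesis phi_bilin : bilinear_form phi.

Lemma bilinear_formMl a a' b :
  phi (a * a', b) = (phi (a, b) + phi (a', b))%R.
Proof. by have /andP[/'forall_'forall_'forall_eqP] := phi_bilin. Qed.

Lemma bilinear_formMr a b b' :
  phi (a, b * b') = (phi (a, b) + phi (a, b'))%R.
Proof. by have /andP[_ /'forall_'forall_'forall_eqP] := phi_bilin. Qed.

Lemma bilinear_form1l b : phi (1, b) = 0%R.
Proof. by apply: (addrI (phi (1, b))); rewrite -bilinear_formMl mul1g addr0. Qed.

Lemma bilinear_form1r a : phi (a, 1) = 0%R.
Proof. by apply: (addrI (phi (a, 1))); rewrite -bilinear_formMr mulg1 addr0. Qed.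

Lemma bilinear_formXl a b n : phi (a ^+ n, b) = (phi (a, b) *+ n)%R.
Proof.
elim: n => [|n IHn]; first by rewrite bilinear_form1l mulr0n.
by rewrite expgS bilinear_formMl IHn mulrS.
Qed.

Lemma bilinear_formXr a b n : phi (a, b ^+ n) = (phi (a, b) *+ n)%R.
Proof.
elim: n => [|n IHn]; first by rewrite bilinear_form1r mulr0n.
by rewrite expgS bilinear_formMr IHn mulrS.
Qed.

End BilinearForm.

Lemma big_cycle_group (R : Type) (idx : R) (op : Monoid.com_law idx)
    (gT : finGroupType) (x : gT) (F : gT -> R) :
  \big[op/idx]_(y in <[x]>) F y = \big[op/idx]_(i < #[x]) F (x ^+ i).
Proof.
have ->: <[x]> = [set x ^+ (i : 'I_#[x]) | i in predT] :> {set gT}.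
  apply/setP=> y; apply/idP/imsetP=> [/cyclePmin[i ltix ->]|[i _ ->]].
    by exists (Ordinal ltix).
  exact: mem_cycle.
by rewrite big_imset //= => i j _ _ /eqP; rewrite eq_expg_ord // => /eqP.
Qed.

Lemma ZmodMn_mod d (c : Zmod d) n : (0 < d)%N -> (c *+ (n %% d) = c *+ n)%R.
Proof.
by case: d c => // d' c _; apply: val_inj; rewrite !Zp_mulrn /= modnMmr.
Qed.

(** * The quotient (G/N)^ab, and the vanishing of Pi when N = G *)

Section AbelianizedQuotient.

Variables (gT : finGroupType) (G S : {group gT}).

Lemma ab_classM : S \subset G ->
  {in G &, {morph ab_class G S : x y / x * y}}.
Proof.
move=> sSG x y Gx Gy; have /andP[_ nNG] := normal_closure_normal sSG.
have Nx := subsetP nNG x Gx; have Ny := subsetP nNG y Gy.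
have Qx : coset (normal_closure S G) x \in G / normal_closure S G by apply: mem_quotient.
have Qy : coset (normal_closure S G) y \in G / normal_closure S G by apply: mem_quotient.
have nD := normal_norm (der_normal 1 (G / normal_closure S G)%G).
apply: val_inj; rewrite /ab_class /=.
rewrite !subgK /= ?mem_quotient ?groupM ?mem_quotient //.
by rewrite morphM // morphM //=; apply: (subsetP nD).
Qed.

Lemma ab_class_surj (a : [subg ab_quotient G S]) :
  exists2 x, x \in G & a = ab_class G S x.
Proof.
case/morphimP: (subgP a) => y Ny /morphimP[x Nx Gx ->] av.
exists x => //; apply: val_inj; rewrite /ab_class /= subgK; first exact: av.
by rewrite -[X in X \in _]av; apply: subgP.
Qed.

Lemma ab_quotient_trivial (a : [subg ab_quotient G S]) :
  normal_closure S G = G -> a = 1.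
Proof.
move=> NG; have [x Gx ->] := ab_class_surj a; rewrite -NG in Gx.
by rewrite /ab_class (coset_id Gx) !morph1.
Qed.

End AbelianizedQuotient.

Section PiTrivial.

Variables (d : nat) (gT hT : finGroupType).
Variables (G S : {group gT}) (H T : {group hT}).

Lemma Pi_trivial_l : normal_closure S G = G -> Pi d G S H T = 1.
Proof.
move=> NG; apply/trivgP/subsetP=> phi; rewrite inE => /and3P[bilin _ _].
by apply/set1P/ffunP=> -[a b]; rewrite (ab_quotient_trivial a NG) bilinear_form1l ?ffunE.
Qed.

Lemma Pi_trivial_r : normal_closure T H = H -> Pi d G S H T = 1.
Proof.
move=> NH; apply/trivgP/subsetP=> phi; rewrite inE => /and3P[bilin _ _].
by apply/set1P/ffunP=> -[a b]; rewrite (ab_quotient_trivial b NH) bilinear_form1r ?ffunE.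
Qed.

End PiTrivial.

Lemma normal_closure_id (gT : finGroupType) (G S : {group gT}) :
  S <| G -> normal_closure S G = S.
Proof.
case/andP=> sSG nSG; apply/eqP; rewrite eqEsubset sub_normal_closure andbT gen_subG.
apply/subsetP=> _ /imset2P[s g Ss Gg ->]; rewrite memJ_norm //.
exact: subsetP nSG g Gg.
Qed.

(** * G cyclic and S trivial: (G/N)^ab is a copy of G *)

Section CyclicAbelianizedQuotient.

Variables (gT : finGroupType) (G S : {group gT}) (x : gT).
Hypotheses (S1 : S :=: 1) (defG : G :=: <[x]>).

Let sSG : S \subset G. Proof. by rewrite S1 sub1G. Qed.

Let Gx n : x ^+ n \in G. Proof. by rewrite defG mem_cycle. Qed.

Lemma ab_class1 : ab_class G S 1 = 1.
Proof. by rewrite /ab_class !morph1. Qed.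

Lemma ab_classX n : ab_class G S (x ^+ n) = ab_class G S x ^+ n.
Proof.
elim: n => [|n IHn]; first exact: ab_class1.
by rewrite !expgS ab_classM // ?IHn //; apply: (Gx 1).
Qed.

Lemma ab_class_gen (a : [subg ab_quotient G S]) :
  exists n, a = ab_class G S x ^+ n.
Proof.
have [y Gy ->] := ab_class_surj a.
have /cycleP[n ->] : y \in <[x]> by rewrite -defG.
by exists n; rewrite ab_classX.
Qed.

(** Both the normal closure of S = 1 and the derived subgroup of an abelian group are trivial, so
    neither quotient identifies distinct powers of [x]. *)
Lemma order_ab_class : #[ab_class G S x] = #[x].
Proof.
have N1 : normal_closure S G = 1 by rewrite normal_closure_id // /normal sSG S1 norms1.
have inj n : ab_class G S (x ^+ n) = 1 -> x ^+ n = 1.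
  have Qxn : coset (normal_closure S G) (x ^+ n) \in G / normal_closure S G.
    exact: mem_quotient.
  have nD := normal_norm (der_normal 1 (G / normal_closure S G)%G).
  move/(congr1 val); rewrite /ab_class subgK ?mem_quotient //=.
  move/coset_idr => /(_ (subsetP nD _ Qxn)).
  have /derG1P D1 : abelian (G / normal_closure S G).
    by rewrite quotient_abelian // defG cycle_abelian.
  have nN : x ^+ n \in 'N(normal_closure S G) by rewrite N1 norm1 inE.
  by rewrite /= D1 => /set1P/coset_idr-/(_ nN); rewrite /= N1 => /set1P.
apply/eqP; rewrite eqn_dvd !order_dvdn -!ab_classX expg_order ab_class1 eqxx /=.
by apply/eqP/inj; rewrite ab_classX expg_order.
Qed.

Lemma sum_rcosets_cycle (M : nmodType) (F : [subg ab_quotient G S] -> M) :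
  (\sum_(y in rcosets S G) F (canonical_surj G S y) =
   \sum_(i < #[x]) F (ab_class G S x ^+ i)%g)%R.
Proof.
(* As S = 1, the cosets are singletons, so the sum can be indexed by the elements of G. *)
rewrite /rcosets [in imset _ _]S1 big_imset /=; last first.
  by move=> y z _ _; rewrite !rcosetE !mul1g => /set1_inj.
transitivity (\sum_(z in <[x]>) F (ab_class G S z))%R.
  apply: eq_big => [z|z _]; first by rewrite defG.
  by rewrite rcosetE -[in LHS]S1 canonical_surjE.
by rewrite big_cycle_group; apply: eq_bigr => i _; rewrite ab_classX.
Qed.

End CyclicAbelianizedQuotient.

(** * Bilinear forms on two cyclic groups of order d *)

Section CyclicPi.

Variables (gT hT : finGroupType) (G S : {group gT}) (H T : {group hT}).
Variables (x : gT) (y : hT).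
Hypotheses (S1 : S :=: 1) (T1 : T :=: 1) (defG : G :=: <[x]>) (defH : H :=: <[y]>).
Hypothesis order_xy : #[x] = #[y].

Local Notation d := #[x].
Local Notation a0 := (ab_class G S x).
Local Notation b0 := (ab_class H T y).

(** Summing over powers of a generator multiplies the value there by 0 + 1 + ... + (d - 1). This
    turns all the conditions into multiples of the single one at the pair of generators. *)
Lemma Pi_cyclic_mem
    (phi : {ffun [subg ab_quotient G S] * [subg ab_quotient H T] -> Zmod d}) :
  bilinear_form phi ->
  (phi \in Pi d G S H T) = (phi (a0, b0) *+ 'C(d, 2) == 0)%R.
Proof.
move=> bilin; rewrite inE bilin /=; set c := phi _.
have suml a : (\sum_(z in rcosets T H) phi (a, canonical_surj H T z) =
               phi (a, b0) *+ 'C(d, 2))%R.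
  rewrite (sum_rcosets_cycle T1 defH (fun b => phi (a, b))) -order_xy.
  rewrite -bin2_sum big_mkord -sumrMnr; apply: eq_bigr => j _.
  exact: bilinear_formXr.
have sumr b : (\sum_(z in rcosets S G) phi (canonical_surj G S z, b) =
               phi (a0, b) *+ 'C(d, 2))%R.
  rewrite (sum_rcosets_cycle S1 defG (fun a => phi (a, b))).
  rewrite -bin2_sum big_mkord -sumrMnr; apply: eq_bigr => j _.
  exact: bilinear_formXl.
apply/andP/eqP=> [[/forall_inP Pl _]|c0].
  have /Pl : S :* x \in rcosets S G.
    by rewrite mem_rcosets mulSGid ?S1 ?sub1G // defG cycle_id.
  by rewrite /form_on_cosets suml canonical_surjE => /eqP.
split; apply/forall_inP=> z _; rewrite /form_on_cosets.
  rewrite suml; have [n ->] := ab_class_gen S1 defG (canonical_surj G S z).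
  by rewrite bilinear_formXl // mulrnAC c0 mul0rn.
rewrite sumr; have [n ->] := ab_class_gen T1 defH (canonical_surj H T z).
by rewrite bilinear_formXr // mulrnAC c0 mul0rn.
Qed.

(** The isomorphism is evaluation at [(a0, b0)]. It is built from its inverse [Phi], which sends c
    to the form with value c i j at the i-th and j-th powers of the generators. *)
Lemma Pi_cyclic_isog (K : {group Zmod d}) :
  (forall c : Zmod d, (c \in K) = (c *+ 'C(d, 2) == 0)%R) ->
  Pi d G S H T \isog K.
Proof.
(* [la] and [lb] choose discrete logarithms to the bases [a0] and [b0]. *)
move=> defK; have [la laP] := fin_all_exists (ab_class_gen S1 defG).
have [lb lbP] := fin_all_exists (ab_class_gen T1 defH).
pose Phi (c : Zmod d) :
    {ffun [subg ab_quotient G S] * [subg ab_quotient H T] -> Zmod d} :=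
  [ffun p => c *+ (la p.1 * lb p.2)]%R.
have PhiE c i j : Phi c (a0 ^+ i, b0 ^+ j) = (c *+ (i * j))%R.
  have /eqP : a0 ^+ la (a0 ^+ i) == a0 ^+ i by rewrite -laP.
  have /eqP : b0 ^+ lb (b0 ^+ j) == b0 ^+ j by rewrite -lbP.
  move/eqP; rewrite eq_expg_mod_order order_ab_class // -order_xy => /eqP lj.
  move/eqP; rewrite eq_expg_mod_order order_ab_class // => /eqP li.
  (* The chosen logarithms agree with i and j only modulo d, which suffices for multiples in Z/d. *)
  rewrite ffunE -ZmodMn_mod ?order_gt0 //= -modnMm li lj modnMm.
  by rewrite ZmodMn_mod ?order_gt0.
have Phi00 c : Phi c (a0, b0) = c by rewrite (PhiE c 1%N 1%N) mulr1n.
have bilinPhi c : bilinear_form (Phi c).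
  apply/andP; split; apply/'forall_'forall_'forall_eqP => u v w.
    rewrite [u]laP [v]laP [w]lbP -expgD !PhiE.
    by rewrite mulnDl mulrnDr.
  rewrite [u]laP [v]lbP [w]lbP -expgD !PhiE.
  by rewrite mulnDr mulrnDr.
have PhiM : {in K &, {morph Phi : c c' / c * c'}}.
  by move=> c c' _ _; apply/ffunP=> p; rewrite !ffunE; exact: mulrnDl.
rewrite isog_sym; apply/isogP; exists (Morphism PhiM).
  apply/injmP=> c c' _ _ /= /(congr1 (fun phi : {ffun _} => phi (a0, b0))).
  by rewrite !Phi00.
rewrite morphimEdom /=; apply/setP=> phi; apply/imsetP/idP=> [[c Kc ->]|Pphi].
  by rewrite Pi_cyclic_mem // Phi00 -defK.
have bilin : bilinear_form phi by move: Pphi; rewrite inE => /and3P[].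
exists (phi (a0, b0)); first by rewrite defK -Pi_cyclic_mem.
apply/ffunP=> -[a b]; rewrite [a]laP [b]lbP PhiE.
by rewrite bilinear_formXl // bilinear_formXr // -mulrnA mulnC.
Qed.

End CyclicPi.

(** * The ['C(d, 2)]-torsion of Z/d, and Pi in the cyclic case *)

(** For d = 2m the binomial is m(d - 1), so 2m divides c m (d - 1) exactly when c (d - 1) is even,
    that is, when c is even. [Zp1 ^+ 2] is the residue of 2, in multiplicative notation. *)
Lemma Zmod_even_torsion d (c : Zmod d) : (0 < d)%N -> ~~ odd d ->
  (c \in <[Zp1 ^+ 2]>) = (c *+ 'C(d, 2) == 0)%R.
Proof.
case: d c => // d c _ even_d.
have dE : d.+1 = ((d.+1)./2 * 2)%N by rewrite muln2 even_halfK.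
have binE : 'C(d.+1, 2) = (d.+1./2 * d)%N by rewrite bin2 /= {1}dE mulnAC muln2 doubleK.
have odd_d : odd d by rewrite -[odd d]negbK.
have zeroE : (c *+ 'C(d.+1, 2) == 0)%R = ~~ odd c.
  rewrite Zp_mulrn -val_eqE /= -/(d.+1 %| _) binE mulnCA {1}dE dvdn_pmul2l.
    by rewrite Euclid_dvdM // !dvdn2 odd_d orbF.
  by rewrite half_gt0; case: (d) odd_d.
rewrite zeroE; apply/idP/idP=> [/cycleP[n ->]|even_c].
  (* Reduction modulo an even number preserves parity. *)
  rewrite -expgM Zp_expg /= modnMml mul1n.
  rewrite -dvdn2 /dvdn modn_dvdm; last by rewrite dvdn2.
  by rewrite modnMr.
rewrite -[c]Zp1_expgz -(even_halfK even_c) -mul2n expgM; exact: mem_cycle.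
Qed.

Lemma card_Zmod_even d : (0 < d)%N -> ~~ odd d -> #|<[Zp1 ^+ 2 : Zmod d]>| = d./2.
Proof.
case: d => // d _ even_d.
by rewrite -[#|_|]/#[Zp1 ^+ 2] orderXdiv order_Zp1 ?dvdn2 // divn2.
Qed.

Lemma cyclic_Zmod n : cyclic [set: Zmod n].
Proof. by rewrite Zp_cycle cycle_cyclic. Qed.

Lemma Pi_cyclic_odd (d : nat) (gT hT : finGroupType)
    (G S : {group gT}) (H T : {group hT}) :
    S :=: 1 -> T :=: 1 -> cyclic G -> cyclic H -> #|G| = d -> #|H| = d ->
  odd d -> Pi d G S H T \isog [set: Zmod d].
Proof.
move=> S1 T1 /cyclicP[x defG] /cyclicP[y defH] cG cH odd_d.
have dE : d = #[x] by rewrite -cG defG.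
have order_xy : #[x] = #[y] by rewrite -dE -cH defH.
(* The type of the forms depends on d, so d itself is replaced by [#[x]]. *)
subst d; rewrite dE in odd_d *; apply: (Pi_cyclic_isog S1 T1 defG defH order_xy).
move=> c; rewrite inE; apply/esym/eqP.
(* For odd d the binomial is a multiple of d and kills Z/d. *)
by rewrite bin2odd // -ZmodMn_mod ?order_gt0 // modnMr mulr0n.
Qed.

Lemma Pi_cyclic_even (d : nat) (gT hT : finGroupType)
    (G S : {group gT}) (H T : {group hT}) :
    S :=: 1 -> T :=: 1 -> cyclic G -> cyclic H -> #|G| = d -> #|H| = d ->
  ~~ odd d -> Pi d G S H T \isog [set: Zmod d./2].
Proof.
move=> S1 T1 /cyclicP[x defG] /cyclicP[y defH] cG cH even_d.
have dE : d = #[x] by rewrite -cG defG.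
have order_xy : #[x] = #[y] by rewrite -dE -cH defH.
have d_gt1 : (1 < d)%N by move: even_d; rewrite -cG; case: #|G| (cardG_gt0 G) => [|[]].
subst d; rewrite dE in even_d d_gt1 *.
have d_gt0 := ltnW d_gt1.
have tor (c : Zmod #[x]) := Zmod_even_torsion c d_gt0 even_d.
apply: isog_trans (Pi_cyclic_isog S1 T1 defG defH order_xy tor) _.
rewrite isog_cyclic_card ?cycle_cyclic // cyclic_Zmod /= cardsT card_ord.
by rewrite card_Zmod_even // prednK ?half_gt0.
Qed.

(** * Maximal subgroups and normal closures *)

Lemma maximal_closure (gT : finGroupType) (G S : {group gT}) :
  maximal S G -> normal_closure S G != G -> S <| G.
Proof.
move=> /maxgroupP[/andP[sSG _] maxS] neN; have nN := normal_closure_normal sSG.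
rewrite -(maxS _ _ (sub_normal_closure G S)) //.
by rewrite properEneq neN normal_sub.
Qed.

(** By Cauchy, G has an element of prime order; the subgroup it generates is not trivial, hence is
    G. *)
Lemma maximal1_prime (gT : finGroupType) (G : {group gT}) :
  maximal 1 G -> prime #|G|.
Proof.
move=> /maxgroupP[]; rewrite proper1G => ntG max1.
have p_pr : prime (pdiv #|G|) by rewrite pdiv_prime ?cardG_gt1.
have [x Gx ox] := Cauchy p_pr (pdiv_dvd _).
have sxG : <[x]> \subset G by rewrite cycle_subG.
have [<-|neG] := eqVneq <[x]> G; first by rewrite -orderE ox.
have /max1/(_ (sub1G _))/(congr1 (fun A : {set gT} => #|A|)) : <[x]> \proper G.
  by rewrite properEneq neG.
by rewrite cards1 -orderE ox => p1; rewrite p1 in p_pr.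
Qed.

(** * The Galois group of an irreducible polynomial and its point stabiliser *)

Section GaloisGroupOfIrreduciblePolynomial.

Variables (k : fieldType) (L : splittingFieldType k) (d : nat) (f : {poly k}).
Variables (rs : seq L) (K : {subfield L}) (xi : L).
Hypothesis char0 : [pchar k]%R =i pred0.
Hypotheses (f_irr : irreducible_poly f) (f_deg : size f = d.+1).
Hypothesis f_split : splitting_field_with_roots f rs K.
Hypothesis f_root : root (map_poly (GRing.in_alg L) f) xi.

Local Notation G := 'Gal(K / 1%AS)%G.
Local Notation S := 'Gal(K / <<1; xi>>%AS)%G.

Let rsK : {subset rs <= K}.
Proof. by case: f_split => _ <- z; apply: seqv_sub_adjoin. Qed.

Let rsE z : (z \in rs) = root (map_poly (GRing.in_alg L) f) z.
Proof. by case: f_split => /eqp_root-> _; rewrite root_prod_XsubC. Qed.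

Let xi_rs : xi \in rs. Proof. by rewrite rsE. Qed.

Let xiK : xi \in K. Proof. exact: rsK. Qed.

Let sub_xi : (<<1; xi>> <= K)%VS.
Proof. by apply/FadjoinP; rewrite sub1v. Qed.

Lemma splitting_field_galois : galois 1 K.
Proof.
case: f_split => fE Kdef; apply/and3P; split; first exact: sub1v.
  apply/separableP=> z _; apply: pcharf0_separable => p.
  by rewrite pchar_lalg char0.
apply/splitting_normalField; first exact: sub1v.
exists (map_poly (GRing.in_alg L) f); last by exists rs.
by apply/polyOver1P; exists f.
Qed.

Lemma minPoly_irr_root : (minPoly 1 xi %= map_poly (GRing.in_alg L) f)%R.
Proof.
have [q minE] := polyOver1P (minPolyOver 1 xi).
have fO : map_poly (GRing.in_alg L) f \is a polyOver 1%VS.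
  by apply/polyOver1P; exists f.
have := minPoly_dvdp fO f_root; rewrite minE dvdp_map => q_f.
rewrite eqp_map; apply: (apply_irredp f_irr) q_f.
(* A divisor of an irreducible polynomial is associate to it unless constant, and the minimal
   polynomial has positive degree. *)
rewrite -(size_map_poly (GRing.in_alg L)) -minE size_minPoly eqSS.
by rewrite adjoin_degreeE -lt0n divn_gt0 ?adim_gt0 // dimvS // subv_adjoin.
Qed.

(** Both orders are degrees of Galois extensions; their quotient is the degree of k(xi) over k,
    which is d because f is the minimal polynomial of [xi] up to a scalar. *)
Lemma card_gal_irr : #|G| = (d * #|S|)%N.
Proof.
have galK := splitting_field_galois.
have galxi : galois <<1; xi>> K by apply: galoisS galK; rewrite subv_adjoin.
rewrite -(galois_dim galK) -(galois_dim galxi) muln_divA ?field_dimS //.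
have <- : \dim <<1; xi>> = d.
  rewrite dim_Fadjoin dimv1 muln1; apply: succn_inj.
  by rewrite -size_minPoly (eqp_size minPoly_irr_root) size_map_poly.
by rewrite mulKn ?adim_gt0 // dimv1 divn1.
Qed.

Lemma gal_root_trans z : z \in rs -> exists2 v, v \in G & v xi = z.
Proof.
move=> zrs; have /and3P[sK _ nK] := splitting_field_galois.
apply: normalField_root_minPoly => //.
by rewrite (eqp_root minPoly_irr_root) -rsE.
Qed.

Let inG (u : gal_of K) : u \in G.
Proof. by rewrite gal_kHom ?sub1v // k1AHom. Qed.

Lemma gal_stab (u : gal_of K) : (u \in S) = (u xi == xi).
Proof.
apply/idP/eqP=> [uS|uxi]; first exact: fixed_gal sub_xi uS (memv_adjoin 1 xi).
have : (<<1; xi>> <= fixedField [set u])%VS.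
  apply/FadjoinP; rewrite sub1v; split=> //.
  by apply/fixedFieldP=> // v /set1P->.
by rewrite -galois_connection // sub1set.
Qed.

Lemma gal_fix_roots (u : gal_of K) : {in rs, forall z, u z = z} -> u = 1.
Proof.
move=> fix_u; apply/eqP/gal_eqP=> z zK; rewrite gal_id.
have : (K <= fixedField [set u])%VS.
  case: f_split => _ Kdef; rewrite -[X in (X <= _)%VS]Kdef.
  apply/Fadjoin_seqP; rewrite sub1v; split=> // y yrs.
  by apply/fixedFieldP=> [|v /set1P->]; [apply: rsK | apply: fix_u].
by move/subvP/(_ z zK)/mem_fixedFieldP => -[_ ->] //; rewrite set11.
Qed.

(** By transitivity a root is [v xi]. Conjugating u by [v^-1] stays in S, hence fixes [xi], which
    says that u fixes [v xi]. *)
Lemma gal_stab_normal : S <| G -> S :=: 1.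
Proof.
case/andP=> _ nSG; apply/trivgP/subsetP=> u uS; apply/set1P/gal_fix_roots => z zrs.
have [v vG <-] := gal_root_trans zrs.
have : u ^ (v^-1) \in S by rewrite memJ_norm // (subsetP nSG) ?groupV.
rewrite gal_stab conjgE invgK => /eqP uvxi.
have := congr1 v uvxi; rewrite -galM ?memv_gal //.
by rewrite -!mulgA mulVg mulg1 galM.
Qed.

Let gal_rs (u : gal_of K) z : z \in rs -> u z \in rs.
Proof.
rewrite !rsE => fz; have fO : map_poly (GRing.in_alg L) f \is a polyOver 1%VS.
  by apply/polyOver1P; exists f.
by rewrite -(fixedPoly_gal (sub1v K) (inG u) fO) rmorph_root.
Qed.

(** Maximality is pulled back along the action [rho] of G on the roots: its image is
    [gal_perms rs K], and the preimage of the stabiliser of [xi] is S. *)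
Lemma gal_stab_maximal : primitive_perm_group (gal_perms rs K) -> maximal S G.
Proof.
pose act u (z : seq_sub rs) : seq_sub rs := SeqSub (gal_rs u (valP z)).
have act_inj u : injective (act u).
  by move=> y z /(congr1 val) /= /fmorph_inj/val_inj.
pose rho u := perm (@act_inj u).
have rhoE u z : val (rho u z) = u (val z) by rewrite permE.
have rhoM : {in G &, {morph rho : u v / u * v}}.
  move=> u v _ _; apply/permP=> z; apply: val_inj.
  by rewrite permM !rhoE galM // rsK ?(valP z).
pose rhom := Morphism rhoM.
have rhoG : rhom @* G = gal_perms rs K.
  apply/setP=> s; rewrite morphimEdom inE.
  apply/imsetP/exists_inP=> -[u uG]; last first.
    move/forallP=> sE; exists u => //; apply/permP=> z; apply: val_inj.
    by rewrite /= rhoE (eqP (sE z)).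
  by move=> ->; exists u => //; apply/forallP=> z; rewrite /= rhoE.
rewrite -rhoG => /andP[_ /forallP/(_ (SeqSub xi_rs))].
rewrite -(morphpre_maximal (f := rhom)) ?subsetIl //.
rewrite morphimGK ?subsetIl //=.
congr (maximal _ _); apply/setP=> u; rewrite !inE gal_stab inG mem_morphim ?inG //=.
by rewrite sub1set inE -val_eqE; congr (_ == _); apply: rhoE.
Qed.

Lemma gal_prime_maximal : prime d -> maximal S G.
Proof.
move=> d_pr; have sSG : S \subset G by apply: galS; apply: sub1v.
apply: p_index_maximal => //.
by rewrite -divgS // card_gal_irr mulnK ?cardG_gt0.
Qed.

Lemma gal_maximal_closure :
  maximal S G -> normal_closure S G != G -> S :=: 1 /\ prime d.
Proof.
move=> maxS ne_N; have S1 := gal_stab_normal (maximal_closure maxS ne_N).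
split=> //; have := card_gal_irr; rewrite S1 cards1 muln1 => <-.
by apply: maximal1_prime; rewrite /= -S1.
Qed.

End GaloisGroupOfIrreduciblePolynomial.

Theorem proposition1p3 (k : fieldType) (L : splittingFieldType k) (d : nat)
    (f g : {poly k}) (rf rg : seq L) (kf kg : {subfield L}) (xi_f xi_g : L)
    (char0 : [pchar k]%R =i pred0)
    (f_irr : irreducible_poly f) (g_irr : irreducible_poly g)
    (f_deg : size f = d.+1) (g_deg : size g = d.+1)
    (f_split : splitting_field_with_roots f rf kf)
    (g_split : splitting_field_with_roots g rg kg)
    (disj : (kf :&: kg)%VS = 1%VS)
    (f_root : root (map_poly (GRing.in_alg L) f) xi_f)
    (g_root : root (map_poly (GRing.in_alg L) g) xi_g) :
  let Gf := 'Gal(kf / 1%AS)%G in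
  let Gg := 'Gal(kg / 1%AS)%G in
  let Sf := 'Gal(kf / <<1; xi_f>>%AS)%G in
  let Sg := 'Gal(kg / <<1; xi_g>>%AS)%G in
  (primitive_perm_group (gal_perms rf kf) \/
     primitive_perm_group (gal_perms rg kg) ->
   ~ [/\ odd d, prime d, cyclic Gf & cyclic Gg] ->
   Pi d Gf Sf Gg Sg = 1%g)
  /\
  ((Gf \isog [set: Zmod d])%g -> (Gg \isog [set: Zmod d])%g ->
   (odd d -> (Pi d Gf Sf Gg Sg \isog [set: Zmod d])%g) /\
   (~~ odd d -> (Pi d Gf Sf Gg Sg \isog [set: Zmod d./2])%g)).
Proof.
move=> Gf Gg Sf Sg.
have d_gt0 : (0 < d)%N by case: f_irr; rewrite f_deg ltnS.
have cGf : #|Gf| = (d * #|Sf|)%N := card_gal_irr char0 f_irr f_deg f_split f_root.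
have cGg : #|Gg| = (d * #|Sg|)%N := card_gal_irr char0 g_irr g_deg g_split g_root.
split=> [prim noncyc|isoGf isoGg].
  have [NGf|neNf] := eqVneq (normal_closure Sf Gf) Gf; first exact: Pi_trivial_l.
  have [NGg|neNg] := eqVneq (normal_closure Sg Gg) Gg; first exact: Pi_trivial_r.
  (* Either primitive group gives this; then both stabilisers have prime index, so from here on f
     and g play symmetric roles. *)
  have d_pr : prime d.
    case: prim => prim.
      have maxS := gal_stab_maximal f_split f_root prim.
      by have [] := gal_maximal_closure char0 f_irr f_deg f_split f_root maxS neNf.
    have maxS := gal_stab_maximal g_split g_root prim.
    by have [] := gal_maximal_closure char0 g_irr g_deg g_split g_root maxS neNg.
  have maxSf := gal_prime_maximal char0 f_irr f_deg f_split f_root d_pr.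
  have maxSg := gal_prime_maximal char0 g_irr g_deg g_split g_root d_pr.
  have [Sf1 _] := gal_maximal_closure char0 f_irr f_deg f_split f_root maxSf neNf.
  have [Sg1 _] := gal_maximal_closure char0 g_irr g_deg g_split g_root maxSg neNg.
  rewrite Sf1 cards1 muln1 in cGf; rewrite Sg1 cards1 muln1 in cGg.
  have cycGf : cyclic Gf by rewrite prime_cyclic ?cGf.
  have cycGg : cyclic Gg by rewrite prime_cyclic ?cGg.
  (* The excluded case is all that odd d allows, so d = 2 and Pi is isomorphic to Z/1. *)
  have even_d : ~~ odd d by apply/negP=> odd_d; apply: noncyc.
  have d2 : d./2 = 1%N by case: (even_prime d_pr) even_d => [->|->].
  have := card_isog (Pi_cyclic_even Sf1 Sg1 cycGf cycGg cGf cGg even_d).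
  by rewrite d2 cardsT card_ord => /card1_trivg.
have [cf cg] : #|Gf| = d /\ #|Gg| = d.
  by rewrite (card_isog isoGf) (card_isog isoGg) cardsT card_ord prednK.
have cycGf : cyclic Gf by rewrite (isog_cyclic isoGf) cyclic_Zmod.
have cycGg : cyclic Gg by rewrite (isog_cyclic isoGg) cyclic_Zmod.
(* A Galois group of order d leaves order 1 for the stabiliser. *)
have Sf1 : Sf :=: 1.
  by apply: card1_trivg; apply/eqP; rewrite -(eqn_pmul2l d_gt0) -cGf cf muln1.
have Sg1 : Sg :=: 1.
  by apply: card1_trivg; apply/eqP; rewrite -(eqn_pmul2l d_gt0) -cGg cg muln1.
by split; [apply: Pi_cyclic_odd | apply: Pi_cyclic_even].
Qed.
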